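(* Let $n_0$ be a positive integer and let $(f_n)_{n\ge n_0}$ be a nondecreasing sequence of positive integers such that $f_{n_0}=1$, \[\sum_{n=n_0}^\infty\frac{f_n}{2^n}\le\frac{1}{4},\] and the sequence $\left(\frac{f_n}{2^n}\right)_{n\ge n_0}$ is nonincreasing (so that $f_n\le f_{n+1}\le 2f_n$ for all $n\ge n_0$). Then there exists an antichain $\mathcal{F}$ of finite subsets of $\mathbb{N}$ such that \[ |\mathcal{F}\cap 2^{[n]}| \ge f_n \] for all $n\ge n_0$.
   Context: $\mathbb{N}=\{1,2,3,\dots\}$, $[n]=\{1,\dots,n\}$, and $2^{X}$ denotes the power set of $X$; thus $\mathcal{F}\cap 2^{[n]}$ is the set of members of $\mathcal{F}$ contained in $[n]$. A family $\mathcal{F}$ of sets is an antichain if $A\not\subseteq B$ for all distinct $A,B\in\mathcal{F}$. *)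

(* Defs.v *)
From mathcomp Require Import all_boot all_order all_algebra finmap.
From mathcomp Require Import all_classical all_reals all_analysis.

Set Implicit Arguments.
Unset Strict Implicit.
Unset Printing Implicit Defensive.

(* The ground set N = {1, 2, ...} is the set of nonzero elements of [nat]. *)
Definition subsets_of_posnat (F : set {fset nat}) : Prop :=
  forall A : {fset nat}, F A -> forall k : nat, k \in A -> (0 < k)%N.

Definition antichain (F : set {fset nat}) : Prop :=
  forall A B : {fset nat}, F A -> F B -> A <> B -> ~ (A `<=` B)%fset.

Definition initial_segment (n : nat) : {fset nat} :=
  [fset k in iota 1 n]%fset.

Definition restriction (F : set {fset nat}) (n : nat) : {fset {fset nat}} :=
  [fset A in fpowerset (initial_segment n) | A \in F]%fset.

(* Main.v *)
(* The antichain grows with n. Along with F_n, an antichain of subsets of [n],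
   keep a down-set W_n of subsets of [n], none of which contains a member of
   F_n. At step n + 1 choose G among the sets of maximal size t in W_n, add the
   sets A + {n+1} with A in G to F_n, and put
   W_(n+1) = W_n + {A + {n+1} : A in W_n \ G}. As G consists of maximal elements
   of W_n, this is again a down-set, and exactly #|G| of the 2 #|W_n| sets are
   lost. With #|G| <= 2 f_(n+1), the bound 1/4 on the series keeps
   #|W_n| >= 2^(n-1) + f_(n+1).

   One also maintains that the layer of W_n of size t has at least f_n sets. If
   the whole layer is used as G, the new top layer consists of the layers t and
   t - 1 of W_n. When 2 t > n the latter is at least as large as the former, by
   double counting, and f_(n+1) <= 2 f_n. When 2 t <= n at most 2^(n-1) sets have
   size less than t, so that layer t of W_n already has f_(n+1) sets. *)

Require Import Defs.
From mathcomp Require Import all_boot all_order all_algebra finmap.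
From mathcomp Require Import all_classical all_reals all_analysis.
From mathcomp Require Import zify.

Set Implicit Arguments.
Unset Strict Implicit.
Unset Printing Implicit Defensive.

Import Order.TTheory GRing.Theory Num.Theory.

Local Open Scope fset_scope.
Local Open Scope nat_scope.

(** * Layers, cones and counting in families of finite sets *)

Section Families.
Variable K : choiceType.
Implicit Types (E A B C : {fset K}) (F G U V W : {fset {fset K}}) (x : K).

Definition downset W := forall B C, B \in W -> C `<=` B -> C \in W.

Definition layer W t : {fset {fset K}} := [fset B in W | #|` B| == t].

Definition cone x W : {fset {fset K}} := [fset x |` B | B in W].

Lemma in_layer W t B : (B \in layer W t) = (B \in W) && (#|` B| == t).
Proof. by rewrite !inE. Qed.

Lemma coneP x W A : reflect (exists2 B, B \in W & A = x |` B) (A \in cone x W).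
Proof. exact: imfsetP. Qed.

Lemma layer_sub W t : layer W t `<=` W.
Proof. by apply/fsubsetP => B; rewrite in_layer => /andP[]. Qed.

Lemma notin_sub E W x B :
  W `<=` fpowerset E -> x \notin E -> B \in W -> x \notin B.
Proof.
move=> /fsubsetP sWE xE /sWE; rewrite fpowersetE => /fsubsetP sBE.
by apply: contra xE => /sBE.
Qed.

Lemma card_cone E W x :
  W `<=` fpowerset E -> x \notin E -> #|` cone x W| = #|` W|.
Proof.
move=> sWE xE; apply: card_in_imfset => B C /= BW CW eqBC.
by rewrite -(fsetU1K (notin_sub sWE xE BW)) eqBC (fsetU1K (notin_sub sWE xE CW)).
Qed.

Lemma card_extend E U V x :
    U `<=` fpowerset E -> V `<=` fpowerset E -> x \notin E ->
  #|` U `|` cone x V| = #|` U| + #|` V|.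
Proof.
move=> sUE sVE xE; rewrite -(card_cone sVE xE).
rewrite -cardfsUI; suff -> : U `&` cone x V = fset0 by rewrite cardfs0 addn0.
apply/fsetP => A; rewrite in_fset0; apply/negbTE/negP.
rewrite in_fsetI => /andP[/(notin_sub sUE xE) xA /coneP[B _ eqA]].
by rewrite eqA fset1U1 in xA.
Qed.

Lemma layer_extend E U V x t :
    V `<=` fpowerset E -> x \notin E ->
  layer (U `|` cone x V) t.+1 = layer U t.+1 `|` cone x (layer V t).
Proof.
move=> sVE xE; apply/fsetP => A; rewrite in_layer !in_fsetU in_layer andb_orl.
congr (_ || _); apply/andP/coneP => [[/coneP[B BV ->]] | [B]].
  rewrite cardfsU1 (notin_sub sVE xE BV) add1n eqSS => Bt.
  by exists B; rewrite ?in_layer ?BV.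
rewrite in_layer => /andP[BV /eqP Bt] ->.
split; first by apply/coneP; exists B.
by rewrite cardfsU1 (notin_sub sVE xE BV) Bt.
Qed.

(* Double counting of the pairs [(A, A `\ x)]. *)
Lemma card_layer_shadow E W t : W `<=` fpowerset E -> downset W ->
  t.+1 * #|` layer W t.+1| <= (#|` E| - t) * #|` layer W t|.
Proof.
move=> sWE dW.
pose s1 := [seq (A `\ x, x) | A <- layer W t.+1, x <- (A : {fset K})].
pose s2 := [seq (B, x) | B <- layer W t, x <- (E `\` B)].
have sz1 : size s1 = t.+1 * #|` layer W t.+1|.
  rewrite size_allpairs_dep sumnE big_map.
  rewrite (eq_big_seq (fun=> t.+1)) => [|A]; last first.
    by rewrite in_layer => /andP[_ /eqP].
  by rewrite big_const_seq count_predT iter_addn_0.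
have sz2 : size s2 = (#|` E| - t) * #|` layer W t|.
  rewrite size_allpairs_dep sumnE big_map.
  rewrite (eq_big_seq (fun=> #|` E| - t)) => [|B]; last first.
    rewrite in_layer => /andP[/(fsubsetP sWE)]; rewrite fpowersetE => sBE /eqP <-.
    by rewrite -cardfsDS.
  by rewrite big_const_seq count_predT iter_addn_0.
rewrite -sz1 -sz2; apply: uniq_leq_size.
  apply: allpairs_uniq_dep => [|A _|]; [exact: fset_uniq|exact: fset_uniq|].
  move=> _ _ /allpairsPdep[A [x [_ xA ->]]] /allpairsPdep[B [y [_ yB ->]]] /=.
  case=> eqAB eqxy; rewrite -{y}eqxy in yB eqAB *.
  by rewrite -(fsetD1K xA) eqAB fsetD1K.
move=> _ /allpairsPdep[A [x [+ xA ->]]].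
rewrite in_layer => /andP[AW /eqP cA]; apply/allpairsPdep.
exists (A `\ x), x; split=> //.
  rewrite in_layer (dW A) ?fsubD1set //=.
  by move: cA; rewrite (cardfsD1 x) xA add1n => -[->].
rewrite !inE eqxx /=; move/(fsubsetP sWE): AW; rewrite fpowersetE.
by move=> /fsubsetP; apply.
Qed.

(* Complementation maps the sets of size less than [t] to sets of size greater
   than [t]. *)
Lemma card_small_sets E t : t.*2 <= #|` E| ->
  (#|` [fset B in fpowerset E | #|` B| < t]|).*2 <= 2 ^ #|` E|.
Proof.
move=> tE; set S := [fset B in _ | _].
have sSE : S `<=` fpowerset E by apply/fsubsetP => B; rewrite !inE => /andP[].
have SP B : B \in S -> B `<=` E /\ #|` B| < t.
  by rewrite !inE /= fpowersetE => /andP[].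
have cS' : #|` [fset E `\` B | B in S]| = #|` S|.
  apply: card_in_imfset => B C /= /SP[BE _] /SP[CE _] eqBC.
  by rewrite -(fsetDK BE) eqBC fsetDK.
rewrite -addnn -{2}cS' -card_fpowerset -cardfsUI.
suff -> : S `&` [fset E `\` B | B in S] = fset0.
  rewrite cardfs0 addn0; apply: fsubset_leq_card; rewrite fsubUset sSE /=.
  apply/fsubsetP => _ /imfsetP[B _ ->].
  by rewrite fpowersetE fsubsetDl.
apply/fsetP => A; rewrite in_fset0; apply/negbTE/negP.
rewrite in_fsetI => /andP[/SP[_ At] /imfsetP[B /= /SP[BE Bt] eqA]].
by move: At; rewrite eqA cardfsDS //; lia.
Qed.

Lemma exists_subset_card W k : k <= #|` W| -> exists2 G, G `<=` W & #|` G| = k.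
Proof.
move=> kW; exists [fset A in take k W].
  by apply/fsubsetP => A; rewrite inE /= => /mem_take.
rewrite card_fseq undup_id ?take_uniq ?fset_uniq // size_take.
by case: ltngtP kW.
Qed.

End Families.

(** * Extending the antichain by one new ground element *)

(* [F] is the part of the antichain built so far, [W] a family of subsets of [E]
   that may still serve as traces on [E] of later members, and [t] bounds the
   sizes of the sets in [W]. *)
Record exhaustion (E : {fset nat}) (F W : {fset {fset nat}}) (t : nat) : Prop :=
  Exhaustion {
    exh_F : F `<=` fpowerset E;
    exh_W : W `<=` fpowerset E;
    exh_anti : antichain [set` F]%classic;
    exh_down : downset W;
    exh_avoid : forall A B, A \in F -> B \in W -> ~ A `<=` B;
    exh_top : forall B, B \in W -> #|` B| <= t
  }.

(** Members of [G] have the maximal size [t], so they lie in no other member of [W]. Deleting [x]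
    reduces each inclusion into a set containing [x] to this fact or to [exh_avoid], and a set
    containing [x] lies in none without it. *)
Lemma exhaustion_extend E F W t x G :
    exhaustion E F W t -> x \notin E -> G `<=` layer W t ->
  exhaustion (x |` E) (F `|` cone x G) (W `|` cone x (W `\` G)) t.+1.
Proof.
case=> sFE sWE aF dW avoid top xE /fsubsetP sGt.
have sGW : G `<=` W by apply/fsubsetP => B /sGt; rewrite in_layer => /andP[].
have sGE := fsubset_trans sGW sWE.
have sDW : W `\` G `<=` W := fsubsetDl W G.
have sDE := fsubset_trans sDW sWE.
have sub_powerset U V : U `<=` fpowerset E -> V `<=` fpowerset E ->
    U `|` cone x V `<=` fpowerset (x |` E).
  move=> /fsubsetP sUE /fsubsetP sVE; apply/fsubsetP => A.
  rewrite in_fsetU fpowersetE => /orP[/sUE|/coneP[B /sVE + ->]].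
    by rewrite fpowersetE => /fsubset_trans; apply; apply: fsubsetU1.
  by rewrite fpowersetE; apply: fsetUS.
have cone_subset B C : x \notin B -> x \notin C ->
    x |` B `<=` x |` C -> B `<=` C.
  by move=> xB xC; rewrite -{2}(fsetU1K xC) fsubsetD1 xB andbT;
    apply: fsubset_trans; apply: fsubsetU1.
have G_maximal A B : A \in G -> B \in W -> A `<=` B -> A = B.
  move=> /sGt; rewrite in_layer => /andP[_ /eqP tA] BW sAB.
  by apply/eqP; rewrite eqEfcard sAB tA top.
split; [exact: sub_powerset|exact: sub_powerset| | | |].
- move=> A B /=; rewrite !in_fsetU.
  move=> /orP[AF|/coneP[A' A'G ->]] /orP[BF|/coneP[B' B'G ->]].
  + exact: aF.
  + move=> _ sAB; apply: (avoid A B' AF); first exact: (fsubsetP sGW).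
    by rewrite -(fsetU1K (notin_sub sGE xE B'G)) fsubsetD1 sAB (notin_sub sFE xE).
  + move=> _ /fsubsetP/(_ x); rewrite fset1U1 => /(_ isT).
    by rewrite (negbTE (notin_sub sFE xE BF)).
  + move=> neqAB /(cone_subset _ _ (notin_sub sGE xE A'G) (notin_sub sGE xE B'G)).
    move=> /(G_maximal _ _ A'G (fsubsetP sGW _ B'G)) eqAB.
    by apply: neqAB; rewrite eqAB.
- move=> B C; rewrite !in_fsetU => /orP[BW /(dW _ _ BW) -> //|].
  move=> /coneP[B' + ->] sCB; rewrite in_fsetD => /andP[B'G B'W].
  have sC : C `\ x `<=` B' by rewrite fsubDset.
  have CW := dW _ _ B'W sC.
  have [xC|xC] := boolP (x \in C); last by rewrite -(mem_fsetD1 xC) CW.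
  apply/orP; right; apply/coneP; exists (C `\ x); last by rewrite fsetD1K.
  rewrite in_fsetD CW andbT; apply: contra B'G => CG.
  by rewrite -(G_maximal _ _ CG B'W sC).
- move=> A B; rewrite !in_fsetU.
  move=> /orP[AF|/coneP[A' A'G ->]] /orP[BW|/coneP[B' B'D ->]].
  + exact: avoid.
  + move=> sAB; apply: (avoid A B' AF); first exact: (fsubsetP sDW).
    by rewrite -(fsetU1K (notin_sub sDE xE B'D)) fsubsetD1 sAB (notin_sub sFE xE).
  + move=> /fsubsetP/(_ x); rewrite fset1U1 => /(_ isT).
    by rewrite (negbTE (notin_sub sWE xE BW)).
  + move=> /(cone_subset _ _ (notin_sub sGE xE A'G) (notin_sub sDE xE B'D)).
    move=> /(G_maximal _ _ A'G (fsubsetP sDW _ B'D)) eqAB.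
    by move: B'D; rewrite in_fsetD -eqAB A'G.
- move=> B; rewrite in_fsetU => /orP[/top/leqW//|/coneP[B' B'D ->]].
  by rewrite cardfsU1 (notin_sub sDE xE B'D) add1n ltnS top ?(fsubsetP sDW).
Qed.

Lemma exhaustion_step E F W t x p q :
    exhaustion E F W t -> x \notin E ->
    p <= q <= p.*2 -> p <= #|` F| -> p <= #|` layer W t| ->
    2 ^ #|` E| + q.*2 <= #|` W|.*2 ->
  exists F' W' t',
    [/\ exhaustion (x |` E) F' W' t', F `<=` F', q <= #|` F'|,
        q <= #|` layer W' t'| & #|` W|.*2 <= #|` W'| + q.*2].
Proof.
move=> exh xE /andP[pq qp] pF pt Wlarge.
have [sFE sWE aF dW avoid top] := exh.
have extend_card G : G `<=` layer W t ->
    #|` F `|` cone x G| = #|` F| + #|` G| /\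
    #|` W `|` cone x (W `\` G)| = #|` W|.*2 - #|` G|.
  move=> sGt; have sGW := fsubset_trans sGt (layer_sub W t).
  rewrite (card_extend sFE (fsubset_trans sGW sWE) xE).
  rewrite (card_extend sWE (fsubset_trans (fsubsetDl _ _) sWE) xE).
  by rewrite (cardfsDS sGW) addnBA -?addnn // fsubset_leq_card.
have layer_le := fsubset_leq_card (layer_sub W t).
(* Spending [q - p] sets of the top layer suffices for [F]; if fewer than [q]
   would be left, the whole layer, of size less than [2q], is spent. *)
have [large|small] := leqP (q - p + q) #|` layer W t|.
  have [|G sGt cG] := @exists_subset_card _ (layer W t) (q - p); first by lia.
  have [cF cW] := extend_card _ sGt.
  exists (F `|` cone x G), (W `|` cone x (W `\` G)), t.+1.
  split; [exact: exhaustion_extend|exact: fsubsetUl| lia| |lia].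
  rewrite (layer_extend _ _ (fsubset_trans (fsubsetDl _ _) sWE) xE).
  have sLE : layer (W `\` G) t `<=` fpowerset E.
    by rewrite (fsubset_trans (layer_sub _ _)) ?(fsubset_trans (fsubsetDl _ _)).
  apply: leq_trans (fsubset_leq_card (fsubsetUr _ _)).
  rewrite (card_cone sLE xE).
  suff -> : layer (W `\` G) t = layer W t `\` G by rewrite cardfsDS //; lia.
  by apply/fsetP => B; rewrite !(in_layer, in_fsetD) andbA.
pose G := layer W t; pose W' := W `|` cone x (W `\` G).
have [cF cW] := extend_card G (fsubset_refl _).
have sDE : W `\` G `<=` fpowerset E := fsubset_trans (fsubsetDl _ _) sWE.
have [sF'E sW'E aF' dW' avoid' _] := exhaustion_extend exh xE (fsubset_refl G).
(* The bound [t] does not grow: only sets of size less than [t] receive [x]. *)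
exists (F `|` cone x G), W', t.
split; [split=> //|exact: fsubsetUl|by rewrite cF /G; lia| |by rewrite cW /G; lia].
  move=> B; rewrite in_fsetU => /orP[/top//|/coneP[C CD ->]].
  rewrite cardfsU1 (notin_sub sDE xE CD) add1n.
  move: CD; rewrite in_fsetD in_layer => /andP[+ CW].
  by rewrite CW ltn_neqAle => /= -> /=; apply: top.
have [tE|Et] := leqP t.*2 #|` E|.
  have := card_small_sets tE; set S := [fset B in _ | _] => cS.
  have : #|` W| <= #|` layer W t| + #|` S|.
    rewrite -cardfsUI; apply: leq_trans (leq_addr _ _).
    apply: fsubset_leq_card; apply/fsubsetP => B BW.
    rewrite in_fsetU in_layer BW [B \in S]in_fset /= inE /= (fsubsetP sWE) //=.
    by rewrite -leq_eqVlt top.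
  have : #|` layer W t| <= #|` layer W' t|.
    apply: fsubset_leq_card; apply/fsubsetP => B.
    by rewrite !in_layer in_fsetU => /andP[-> ->].
  by lia.
have [s ts] : exists s, t = s.+1 by exists t.-1; lia.
subst t; rewrite (layer_extend _ _ sDE xE).
have -> : layer (W `\` G) s = layer W s.
  apply/fsetP => B; rewrite !(in_layer, in_fsetD).
  by case: (B \in W); rewrite ?andbF ?andbT //=; case: eqP => // ->; lia.
rewrite (card_extend (fsubset_trans (layer_sub _ _) sWE)
                     (fsubset_trans (layer_sub _ _) sWE) xE).
suff : #|` layer W s.+1| <= #|` layer W s| by lia.
rewrite -(leq_pmul2l (ltn0Sn s)).
apply: leq_trans (card_layer_shadow s sWE dW) _.
by rewrite leq_mul2r; apply/orP; right; lia.
Qed.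

(** * Partial sums of the series *)

(** The partial sum of [f m / 2 ^ m], scaled by [2 ^ n] to stay in [nat]. *)
Definition weighted_sum (f : nat -> nat) n0 n :=
  \sum_(n0 <= m < n.+1) f m * 2 ^ (n - m).

Lemma weighted_sumS f n0 n : n0 <= n ->
  weighted_sum f n0 n.+1 = (weighted_sum f n0 n).*2 + f n.+1.
Proof.
move=> n0n; rewrite /weighted_sum big_nat_recr /= 1?leqW // subnn muln1.
congr (_ + _); rewrite -mul2n big_distrr /=; apply: eq_big_nat => m /andP[_ mn].
by rewrite subSn // expnS mulnCA.
Qed.

Lemma weighted_sum_le (R : realType) (f : nat -> nat) n0 n :
  (\sum_(n0 <= n <oo) ((f n)%:R / 2 ^+ n : R)%:E <= (1 / 4 : R)%:E)%E ->
  4 * weighted_sum f n0 n <= 2 ^ n.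
Proof.
move=> fsum.
have le14 : (\sum_(n0 <= m < n.+1) (f m)%:R / 2 ^+ m <= 1 / 4 :> R)%R.
  rewrite -lee_fin -sumEFin; apply: le_trans fsum.
  by apply: nneseries_lim_ge => m _ _; rewrite lee_fin divr_ge0 // exprn_ge0.
have exp_gt0 : (0 < 2 ^+ n :> R)%R by rewrite exprn_gt0.
rewrite -(ler_nat R) natrM natr_sum natrX mulrC -ler_pdivlMr //.
apply: le_trans (_ : (2 ^+ n * (1 / 4) <= _)%R); last by rewrite div1r.
rewrite -ler_pdivrMl // mulrC mulr_suml.
apply: le_trans le14; rewrite le_eqVlt; apply/orP; left; apply/eqP.
apply: eq_big_nat => m /andP[_ mn].
rewrite natrM natrX -mulrA; congr (_ * _)%R.
have -> : (2 ^+ n = 2 ^+ (n - m) * 2 ^+ m :> R)%R by rewrite -exprD subnK.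
by rewrite invfM mulrA divff ?mul1r // expf_neq0.
Qed.

(** * Stages of the construction *)

Lemma mem_initial_segment n k : (k \in initial_segment n) = (0 < k <= n).
Proof. by rewrite /initial_segment in_fset /= mem_iota add1n ltnS. Qed.

Lemma initial_segmentS n : initial_segment n.+1 = n.+1 |` initial_segment n.
Proof.
by apply/fsetP => k; rewrite in_fset1U !mem_initial_segment; lia.
Qed.

Lemma card_initial_segment n : #|` initial_segment n| = n.
Proof. by rewrite card_fseq undup_id ?iota_uniq // size_iota. Qed.

(** The triple [s] is [(F, W, t)]. The last bound counts losses: up to [2 * f m] sets lost at step
    [m], doubled at each of the [n - m] later steps. *)
Definition stage (f : nat -> nat) n0 n
    (s : {fset {fset nat}} * {fset {fset nat}} * nat) :=
  [/\ exhaustion (initial_segment n) s.1.1 s.1.2 s.2, f n <= #|` s.1.1|,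
      f n <= #|` layer s.1.2 s.2| &
      2 ^ n <= #|` s.1.2| + (weighted_sum f n0 n).*2].

Lemma stage_init f n0 : 0 < n0 -> f n0 = 1 -> exists s, stage f n0 n0 s.
Proof.
case: n0 => // n _ fn; set E := initial_segment n.+1.
have cE : #|` E| = n.+1 by rewrite card_initial_segment.
(* Proper subsets of [E] have at most [n] elements, a size attained by removing one point. *)
exists ([fset E], fpowerset E `\ E, n); split => /=.
- split.
  + by rewrite fsub1set fpowersetE.
  + exact: fsubD1set.
  + by move=> A B /=; rewrite !inE => /eqP-> /eqP->.
  + move=> B C; rewrite !in_fsetD1 !fpowersetE => /andP[BE sBE] sCB.
    rewrite (fsubset_trans sCB sBE) andbT; apply: contra BE => /eqP CE.
    by rewrite eqEfsubset sBE -CE.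
  + move=> A B; rewrite in_fset1 in_fsetD1 fpowersetE => /eqP-> /andP[BE sBE] sEB.
    by move: BE; rewrite eqEfsubset sBE sEB.
  + move=> B; rewrite in_fsetD1 fpowersetE => /andP[BE sBE].
    rewrite -ltnS -cE ltnNge; apply: contra BE => ?.
    by rewrite eqEfcard sBE.
- by rewrite fn cardfs1.
- rewrite fn cardfs_gt0; apply/fset0Pn; exists (E `\ n.+1).
  have nE : n.+1 \in E by rewrite mem_initial_segment leqnn.
  rewrite in_layer in_fsetD1 fpowersetE fsubD1set andbT.
  move: cE; rewrite (cardfsD1 n.+1) nE add1n => -[->]; rewrite eqxx andbT.
  by apply/eqP => eqE; move: nE; rewrite -eqE !inE eqxx.
- have := card_fpowerset E; rewrite (cardfsD1 E) fpowersetE fsubset_refl cE.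
  by rewrite /weighted_sum big_nat1 fn subnn addnC => <-; rewrite leq_add2l.
Qed.

Lemma stage_next f n0 n s :
    n0 <= n -> f n <= f n.+1 <= (f n).*2 ->
    4 * weighted_sum f n0 n.+1 <= 2 ^ n.+1 ->
    stage f n0 n s ->
  exists2 s', stage f n0 n.+1 s' & s.1.1 `<=` s'.1.1.
Proof.
case: s => [[F W] t] n0n fle; rewrite weighted_sumS // expnS => sum_le.
case=> /= exh fF ft cW.
have nE : n.+1 \notin initial_segment n by rewrite mem_initial_segment ltnn andbF.
have [|F' [W' [t' [exh' sFF' fF' ft' cW']]]] := exhaustion_step exh nE fle fF ft.
  by rewrite card_initial_segment /=; lia.
exists (F', W', t') => //; split=> //=; first by rewrite initial_segmentS.
by rewrite weighted_sumS // expnS; move: cW cW' => /=; lia.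
Qed.

(** * The union of the stages *)

Theorem theorem3 (R : realType) (n0 : nat) (f : nat -> nat)
  (n0_gt0 : (0 < n0)%N)
  (f_gt0 : forall n : nat, (n0 <= n)%N -> (0 < f n)%N)
  (f_nondecreasing :
    forall m n : nat, (n0 <= m)%N -> (m <= n)%N -> (f m <= f n)%N)
  (f_n0 : f n0 = 1%N)
  (f_sum :
    (\sum_(n0 <= n <oo) ((f n)%:R / 2 ^+ n : R)%:E <= (1 / 4 : R)%:E)%E)
  (f_ratio_nonincreasing :
    forall m n : nat, (n0 <= m)%N -> (m <= n)%N ->
      ((f n)%:R / 2 ^+ n <= (f m)%:R / 2 ^+ m :> R)%R) :
  exists F : set {fset nat},
    [/\ subsets_of_posnat F, antichain F &
        forall n : nat, (n0 <= n)%N -> (f n <= #|` restriction F n|)%N].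
Proof.
have f_growth n : n0 <= n -> f n <= f n.+1 <= (f n).*2.
  move=> n0n; rewrite f_nondecreasing //=.
  have := f_ratio_nonincreasing n n.+1 n0n (leqnSn n).
  rewrite exprS invfM mulrA ler_pM2r ?invr_gt0 ?exprn_gt0 //.
  by rewrite ler_pdivrMr // -natrM ler_nat muln2.
have [s0 stage0] := stage_init n0_gt0 f_n0.
(* Choice needs a successor for every pair, so the property is conditional; pairs that are not
   stages return [s] itself. *)
have [|next nextP] := @choice _ _ (fun (ns : nat * _) s' => n0 <= ns.1 ->
    stage f n0 ns.1 ns.2 -> stage f n0 ns.1.+1 s' /\ ns.2.1.1 `<=` s'.1.1).
  move=> [n s] /=; have [n0n|] := boolP (n0 <= n); last by exists s.
  have [sn|] := pselect (stage f n0 n s); last by exists s.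
  have [|s' ? ?] := stage_next n0n (f_growth n n0n) _ sn.
    exact: weighted_sum_le f_sum.
  by exists s'.
pose fix u k := if k is k'.+1 then next (n0 + k', u k') else s0.
have u_stage k : stage f n0 (n0 + k) (u k).
  elim: k => [|k IHk]; first by rewrite addn0.
  by rewrite addnS; apply: (nextP (n0 + k, u k) (leq_addr _ _) IHk).1.
have u_sub : {homo (fun k => (u k).1.1) : i j / i <= j >-> i `<=` j}.
  apply: homo_leq => [A|B A C|k]; [exact: fsubset_refl|exact: fsubset_trans|].
  exact: (nextP (n0 + k, u k) (leq_addr _ _) (u_stage k)).2.
exists [set A | exists k, A \in (u k).1.1]%classic; split.
- move=> A [k Ak] i iA; have [exh _ _ _] := u_stage k.
  move/(fsubsetP (exh_F exh)): Ak; rewrite fpowersetE => /fsubsetP/(_ i iA).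
  by rewrite mem_initial_segment => /andP[].
(* Both sets already belong to the antichain of the later stage. *)
- move=> A B [i Ai] [j Bj]; have [exh _ _ _] := u_stage (maxn i j).
  apply: (exh_anti exh) => /=.
    exact: (fsubsetP (u_sub _ _ (leq_maxl i j))).
  exact: (fsubsetP (u_sub _ _ (leq_maxr i j))).
- move=> n n0n; have [exh fF _ _] := u_stage (n - n0).
  rewrite subnKC // in exh fF; apply: leq_trans fF _.
  apply: fsubset_leq_card; apply/fsubsetP => A AF.
  rewrite /restriction !inE /= (fsubsetP (exh_F exh)) //=.
  by apply/mem_set; exists (n - n0).
Qed.
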